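(* Let $n,m\ge1$, $G=K_n$, $d=n+\binom n2$, and $a^*\in\{0,1,\dots,m\}^n$. Then there exists $a\in\mathbb{Z}^d$ with $\pi(a)=a^*$ such that for any graphical valuations $v^1,\dots,v^m$ with underlying graph $K_n$ there exist a price $p\in\mathbb{R}^d$ and $a^1,\dots,a^m\in\{0,1\}^d$ with $a=\sum_{b=1}^m a^b$ and $a^b\in D(v^b,p)$ for all $b\in[m]$ (a competitive equilibrium at $a$).
   Context: Vectors in $\mathbb{R}^d$ are indexed by $[n]\sqcup\binom{[n]}{2}$. For $S\subseteq[n]$, $a_S\in\{0,1\}^d$ has $a_{S,i}=1$ iff $i\in S$ and $a_{S,ij}=1$ iff $i,j\in S$. A graphical valuation with underlying graph $K_n$ is $v(S)=\langle w,a_S\rangle$ for some $w\in\mathbb{R}^d$; an anonymous graphical price $p\in\mathbb{R}^d$ charges $\langle p,a_S\rangle$ for $S$. $D(v,p)=\{a_S: S\in\arg\max_{S\subseteq[n]}(v(S)-\langle p,a_S\rangle)\}$. $\pi:\mathbb{R}^d\to\mathbb{R}^n$ is the projection onto the vertex coordinates. *)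

(* Defs.v *)
From HB Require Import structures.
From mathcomp Require Import all_boot all_order all_algebra.
From mathcomp Require Import boolp classical_sets reals.

Set Implicit Arguments.
Unset Strict Implicit.
Unset Printing Implicit Defensive.

Import Order.TTheory GRing.Theory Num.Theory.
Local Open Scope ring_scope.

(* The edges of the complete graph K_n, i.e. the 2-element subsets of [n]. *)
Definition edge (n : nat) : finType := {e : {set 'I_n} | #|e| == 2%N}.

(* The coordinates of R^d, where d = n + 'C(n, 2): [inl i] is the vertex
   coordinate i, and [inr e] is the edge coordinate ij for e = {i, j}. *)
Definition coordinate (n : nat) : finType := ('I_n + edge n)%type.

(* The 0/1 vector a_S. It is an integer vector, so that bundles to be allocated
   live in Z^d; real weights and prices are paired with it by [pairing]. *)
Definition bundle_vector (n : nat) (S : {set 'I_n}) : {ffun coordinate n -> int} :=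
  [ffun k : coordinate n => match k with
             | inl i => (i \in S)%:Z
             | inr e => (val e \subset S)%:Z
             end].

Definition pairing (R : realType) (n : nat)
    (w : {ffun coordinate n -> R}) (x : {ffun coordinate n -> int}) : R :=
  \sum_k w k * (x k)%:~R.

Definition graphical (R : realType) (n : nat) (v : {set 'I_n} -> R) : Prop :=
  exists w : {ffun coordinate n -> R}, forall S, v S = pairing w (bundle_vector S).

Definition utility (R : realType) (n : nat) (v : {set 'I_n} -> R)
    (p : {ffun coordinate n -> R}) (S : {set 'I_n}) : R :=
  v S - pairing p (bundle_vector S).

Definition demand (R : realType) (n : nat) (v : {set 'I_n} -> R)
    (p : {ffun coordinate n -> R}) : set {ffun coordinate n -> int} :=
  [set bundle_vector S |
    S in [set S | forall T, utility v p T <= utility v p S]]%classic.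

Definition vertex_proj (n : nat) (x : {ffun coordinate n -> int}) :
    {ffun 'I_n -> int} :=
  [ffun i => x (inl i : coordinate n)].

Definition competitive_equilibrium (R : realType) (n m : nat)
    (v : 'I_m -> {set 'I_n} -> R) (a : {ffun coordinate n -> int})
    (p : {ffun coordinate n -> R}) (x : 'I_m -> {ffun coordinate n -> int}) : Prop :=
  a = \sum_(b < m) x b /\ forall b, demand (v b) p (x b).

(* Main.v *)
Require Import Defs.
From HB Require Import structures.
From mathcomp Require Import all_boot all_order all_fingroup all_algebra.
From mathcomp Require Import boolp classical_sets reals.
From mathcomp Require Import ring lra.

(** Take for [a] the sum of the bundles of the superlevel sets
    [T_c = {i | c < astar i}], [c < m].  These sets form a chain, and they are
    exactly the minimizers of a graphical function (a face of the correlation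
    polytope).  Restricted to the chain, the market is an assignment problem
    between the [m] agents and the [m] sets [T_c]; an optimal assignment is
    supported by prices [q_c], the potentials of a digraph without positive
    cycles.  A modular function takes the values [q_c], up to a constant, on the
    chain, and adding a large multiple of the function minimized on the chain
    makes every other set too expensive. *)

Set Implicit Arguments.
Unset Strict Implicit.
Unset Printing Implicit Defensive.

Import Order.TTheory GRing.Theory Num.Theory.
Local Open Scope ring_scope.

(** * Potentials of a weighted digraph *)

Section Potentials.
Variables (R : realType) (T : finType) (A : T -> T -> R).

Fixpoint walk_sum (x : T) (p : seq T) : R :=
  if p is y :: p' then A x y + walk_sum y p' else 0.

Lemma walk_sum_cat x p1 p2 :
  walk_sum x (p1 ++ p2) = walk_sum x p1 + walk_sum (last x p1) p2.
Proof. by elim: p1 x => [|y p1 IH] x /=; rewrite ?add0r // IH addrA. Qed.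

(** The closing point [y0] is kept apart from the head [x] because the induction changes the head;
    taking [y0] to be [x] gives the cycle. *)
Lemma walk_sum_next_at y0 x p : uniq (x :: p) ->
  \sum_(i <- x :: p) A i (next_at i y0 x p) = walk_sum x (rcons p y0).
Proof.
elim: p x => [|y p IH] x; first by rewrite big_seq1 /= eqxx addr0.
move=> /[dup] /= /andP[xNp _] /andP[_ Uyp].
rewrite big_cons /= eqxx -IH //; congr (_ + _).
apply: eq_big_seq => i ip /=; case: eqP => // ix.
by move: xNp; rewrite -ix ip.
Qed.

Hypothesis A_diag : forall i, A i i = 0.
Hypothesis A_perm : forall s : {perm T}, \sum_i A i (s i) <= 0.

(** The cycle extends to the permutation [next (x :: p)], which fixes the points outside it, where
    [A i i = 0]. *)
Lemma simple_cycle_le0 x p : uniq (x :: p) -> walk_sum x (rcons p x) <= 0.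
Proof.
move=> Uxp; rewrite -walk_sum_next_at //.
have := A_perm (perm (can_inj (prev_next Uxp))).
under eq_bigr do rewrite permE.
have out i : i \notin x :: p -> A i (next (x :: p) i) = 0.
  by move=> iNp; rewrite next_nth (negPf iNp).
by rewrite (bigID [in x :: p]) /= addrC big1 ?add0r -?big_uniq.
Qed.

(* The potential of [j] is the length of the longest simple path from a fixed
   root to [j]; only simple cycles are needed to bound and to compare these. *)
Lemma potential_exists : T -> exists q : T -> R, forall i j, q i + A i j <= q j.
Proof.
move=> r.
pose P j : set R :=
  [set z | exists p, [/\ uniq (r :: p), last r p = j & z = walk_sum r p]]%classic.
have P_ub j : has_ubound (P j).
  exists (- A j r) => _ [p [Up lp ->]].
  have := simple_cycle_le0 Up; rewrite -cats1 walk_sum_cat lp /= addr0; lra.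
have P_nonempty j : (P j !=set0)%classic.
  have [->|jr] := eqVneq j r; first by exists 0, [::].
  by exists (A r j), [:: j]; split; rewrite //= ?addr0 // inE eq_sym jr.
exists (fun j => sup (P j)) => i j; rewrite -lerBrDr.
apply: ge_sup => // _ [p [Up lp ->]]; rewrite lerBrDr.
have [jp|jNp] := boolP (j \in r :: p); last first.
  apply: ub_le_sup => //; exists (rcons p j); split.
  - by rewrite -rcons_cons rcons_uniq jNp.
  - by rewrite last_rcons.
  - by rewrite -cats1 walk_sum_cat lp /= addr0.
(* Cut the path at [j]: its tail, closed by the edge from [i] to [j], is a simple cycle of sum at
   most 0, so the initial piece is already long enough. *)
case/splitPl: jp Up lp => p1 p2 lp1.
rewrite -cat_cons cat_uniq => /and3P[Up1 disj Up2]; rewrite last_cat lp1 => lp2.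
have Ujp2 : uniq (j :: p2).
  rewrite /= Up2 andbT; apply: contra disj => jp2.
  by apply/hasP; exists j => //; rewrite -lp1 /= mem_last.
have := simple_cycle_le0 Ujp2; rewrite -cats1 !walk_sum_cat lp1 lp2 /= addr0.
have : walk_sum r p1 <= sup (P j) by apply: ub_le_sup => //; exists p1.
lra.
Qed.

End Potentials.

(** * Optimal assignments and their prices *)

Lemma assignment_prices (R : realType) (T : finType) (W : T -> T -> R) : T ->
  exists (s : {perm T}) (q : T -> R),
    forall i j, W i j - q j <= W i (s i) - q (s i).
Proof.
move=> r.
pose F (s : {perm T}) := \sum_i W i (s i).
have [s s_max] : exists s, forall t, F t <= F s.
  have [|s _ s_max] := @Order.TotalTheory.arg_maxP _ _ _ (1%g : {perm T}) predT F.
    by [].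
  by exists s => t; exact: s_max.
(* The gain of [i] from trading its own item for that of [j]; optimality of [s] makes the total gain
   along any permutation nonpositive. *)
pose A i j := W i (s j) - W i (s i).
have [|t|q Aq] := @potential_exists R T A _ _ r.
- by move=> i; rewrite /A subrr.
- rewrite /A big_split /= sumrN subr_le0.
  under eq_bigr do rewrite -permM.
  exact: s_max.
(* Potentials live on agents: an item costs the potential of its holder. *)
exists s, (fun j => q ((s^-1)%g j)) => i j; rewrite permK.
by have := Aq i ((s^-1)%g j); rewrite /A permKV; lra.
Qed.

(** * Closure properties of graphical functions *)

Section Graphical.
Variables (R : realType) (n : nat).
Implicit Types (f g : {set 'I_n} -> R) (S : {set 'I_n}).

Lemma graphical_ext f g : f =1 g -> graphical f -> graphical g.
Proof. by move=> fg [w fw]; exists w => S; rewrite -fg. Qed.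

Lemma graphicalD f g :
  graphical f -> graphical g -> graphical (fun S => f S + g S).
Proof.
move=> [w fw] [u gu]; exists (w + u) => S; rewrite fw gu -big_split.
by apply: eq_bigr => k _; rewrite [(w + u) k]ffunE mulrDl.
Qed.

Lemma graphicalZ c f : graphical f -> graphical (fun S => c * f S).
Proof.
move=> [w fw]; exists [ffun k => c * w k] => S; rewrite fw big_distrr.
by apply: eq_bigr => k _; rewrite [in RHS]ffunE -mulrA.
Qed.

Lemma graphical0 : graphical (fun S => 0 : R).
Proof.
by exists 0 => S; rewrite /pairing big1 // => k _; rewrite ffunE mul0r.
Qed.

Lemma graphical_sum (I : finType) (P : pred I) (F : I -> {set 'I_n} -> R) :
  (forall i, P i -> graphical (F i)) -> graphical (fun S => \sum_(i | P i) F i S).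
Proof.
move=> gF; elim: (index_enum I) => [|i s IH].
  by apply: graphical_ext graphical0 => S; rewrite big_nil.
have [Pi|PNi] := boolP (P i).
  by apply: graphical_ext (graphicalD (gF i Pi) IH) => S; rewrite big_cons Pi.
by apply: graphical_ext IH => S; rewrite big_cons (negPf PNi).
Qed.

Lemma graphical_coordinate (k : coordinate n) :
  graphical (fun S => (bundle_vector S k)%:~R : R).
Proof.
exists [ffun l => (l == k)%:R] => S; rewrite /pairing (bigD1 k) //=.
rewrite !ffunE eqxx mul1r big1 ?addr0 // => l /negPf lk.
by rewrite !ffunE lk mul0r.
Qed.

Lemma graphical_mem i : graphical (fun S => (i \in S)%:R : R).
Proof.
by apply: graphical_ext (graphical_coordinate (inl i)) => S; rewrite ffunE.
Qed.

Lemma graphical_mem2 i j : graphical (fun S => ((i \in S) && (j \in S))%:R : R).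
Proof.
(* No coordinate stands for a loop; on the diagonal the product is the vertex indicator. *)
have [->|ij] := eqVneq i j.
  by apply: graphical_ext (graphical_mem j) => S; rewrite andbb.
have cij : #|[set i; j]| == 2%N by rewrite cards2 ij.
pose e : edge n := exist _ [set i; j] cij.
apply: graphical_ext (graphical_coordinate (inr e)) => S.
by rewrite ffunE /= finset.subUset !finset.sub1set.
Qed.

End Graphical.

(** * Chains of superlevel sets *)

Definition superlevel (n : nat) (k : 'I_n -> nat) (c : nat) : {set 'I_n} :=
  [set i | (c < k i)%N].

(** The level is the largest value of [k] outside [S]; if [S] is everything, this maximum is 0, and
    then no vertex has value 0. *)
Lemma superlevel_recognize n m (k : 'I_n -> nat) (S : {set 'I_n}) :
    (0 < m)%N -> (forall i, (k i <= m)%N) ->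
    (forall i j, (k j <= k i)%N -> j \in S -> i \in S) ->
    (forall i, k i = 0%N -> i \notin S) -> (forall i, k i = m -> i \in S) ->
  exists2 c, (c < m)%N & S = superlevel k c.
Proof.
move=> m0 km up lo hi; exists (\max_(i | i \notin S) k i)%N.
  apply: (big_ind (fun c => c < m)%N) => // [x y|i iNS].
    by rewrite gtn_max => -> ->.
  rewrite ltn_neqAle km andbT; apply: contra iNS => /eqP; exact: hi.
apply/setP => i; rewrite inE.
have [iS|iNS] := boolP (i \in S); last first.
  by apply/esym/negbTE; rewrite -leqNgt; apply: leq_bigmax_cond.
apply/esym; apply: (big_ind (fun c => c < k i)%N) => [|x y|j jNS].
- by rewrite lt0n; apply: contraL iS => /eqP; exact: lo.
- by rewrite gtn_max => -> ->.
- by rewrite ltnNge; apply: contra jNS => /up; apply.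
Qed.

Section Chain.
Variables (R : realType) (n : nat) (k : 'I_n -> nat).

(* If no vertex has value [c + 1], the two consecutive levels coincide;
   otherwise the indicator of such a vertex separates [T_0, ..., T_c] from the
   later levels. *)
Lemma superlevel_interpolation (q : nat -> R) (M : nat) :
    (forall c, (c < M)%N -> superlevel k c = superlevel k c.+1 -> q c = q c.+1) ->
  exists2 l, graphical l & forall c, l (superlevel k c) = q (minn c M) - q M.
Proof.
elim: M => [|M IH] qE.
  by exists (fun=> 0) => [|c]; [exact: graphical0 | rewrite minn0 subrr].
have [c cM|l gl lE] := IH; first by apply: qE; rewrite ltnW.
have [/existsP[i /eqP ki]|noi] := boolP [exists i, k i == M.+1].
  exists (fun S => l S + (q M - q M.+1) * (i \in S)%:R) => [|c].
    by apply/graphicalD/graphicalZ/graphical_mem.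
  rewrite lE inE ki ltnS; have [cM|Mc] := leqP c M.
    by rewrite (minn_idPl (leqW cM)) mulr1; ring.
  by rewrite (minn_idPr Mc) !subrr mulr0 addr0.
have qM : q M = q M.+1.
  apply: qE => //; apply/setP => i; rewrite !inE [RHS]ltn_neqAle.
  by rewrite eq_sym (existsPn noi i).
exists l => // c; rewrite lE -qM; congr (_ - _).
have [cM|Mc] := leqP c M; first by rewrite (minn_idPl (leqW cM)).
by rewrite (minn_idPr Mc).
Qed.

Lemma superlevel_penalty (m : nat) : (0 < m)%N -> (forall i, (k i <= m)%N) ->
  exists (h : {set 'I_n} -> R) (c0 : R), [/\ graphical h,
    forall c, (c < m)%N -> h (superlevel k c) + c0 = 0 &
    forall S, (exists2 c, (c < m)%N & S = superlevel k c) \/ 1 <= h S + c0].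
Proof.
move=> m0 km.
(* [H] counts the violations of the three conditions of [superlevel_recognize], so [H S < 1] forces
   them all. *)
pose H (S : {set 'I_n}) : R :=
  \sum_(x : 'I_n * 'I_n | (k x.2 <= k x.1)%N) ((x.2 \in S) && (x.1 \notin S))%:R
  + \sum_(i | k i == 0%N) (i \in S)%:R + \sum_(i | k i == m) (i \notin S)%:R.
(* The constant left after writing non-membership as 1 minus membership; a graphical function
   vanishes at the empty set and cannot absorb it. *)
pose c0 : R := \sum_(i | k i == m) 1.
exists (fun S => H S - c0), c0; split => [|c cm|S].
- pose h (S : {set 'I_n}) : R :=
    \sum_(x : 'I_n * 'I_n | (k x.2 <= k x.1)%N)
      ((x.2 \in S)%:R + -1 * ((x.2 \in S) && (x.1 \in S))%:R)
    + \sum_(i | k i == 0%N) (i \in S)%:R + \sum_(i | k i == m) -1 * (i \in S)%:R.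
  have gh : graphical h.
    apply: graphicalD; first apply: graphicalD.
    + apply: graphical_sum => x _; apply: graphicalD; first exact: graphical_mem.
      exact/graphicalZ/graphical_mem2.
    + by apply: graphical_sum => i _; exact: graphical_mem.
    + by apply: graphical_sum => i _; exact/graphicalZ/graphical_mem.
  apply: graphical_ext gh => S; rewrite /h /H /c0 -[RHS]addrA -sumrB.
  congr (_ + _ + _).
    by apply: eq_bigr => x _; case: (x.2 \in S); case: (x.1 \in S) => /=; ring.
  by apply: eq_bigr => i _; case: (i \in S) => /=; ring.
- rewrite subrK /H !big1 ?addr0 // => [i /eqP ki|i /eqP ki|x kx].
  + by rewrite inE ki cm.
  + by rewrite inE ki.
  + rewrite !inE; have [cx|//] := ltnP c (k x.2).
    by rewrite (leq_trans cx kx).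
rewrite subrK.
have sum_ge0 (I : finType) (P b : pred I) : 0 <= \sum_(i | P i) (b i)%:R :> R.
  by apply: sumr_ge0.
have sum_ge1 (I : finType) (P b : pred I) i :
    P i -> b i -> 1 <= \sum_(i | P i) (b i)%:R :> R.
  by move=> Pi bi; rewrite (bigD1 i) //= bi lerDl; apply: sum_ge0.
set h1 := fun x : 'I_n * 'I_n => (x.2 \in S) && (x.1 \notin S).
have [?|H1] := leP 1 (H S); [by right | left].
have [[h1_ge0 h2_ge0] h3_ge0] := (sum_ge0 _ (fun x => k x.2 <= k x.1)%N h1,
  sum_ge0 _ (fun i => k i == 0%N) [in S], sum_ge0 _ (fun i => k i == m) [predC S]).
apply: superlevel_recognize => // [i j kij jS|i ki|i ki].
- apply/negPn/negP => iNS.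
  have := @sum_ge1 _ (fun x => k x.2 <= k x.1)%N h1 (i, j) kij.
  rewrite /h1 jS iNS => /(_ isT); move: H1 h1_ge0 h2_ge0 h3_ge0.
  rewrite /H /h1 /=; lra.
- apply/negP => iS.
  have := @sum_ge1 _ (fun i => k i == 0%N) [in S] i.
  rewrite ki iS => /(_ erefl isT); move: H1 h1_ge0 h2_ge0 h3_ge0.
  rewrite /H /h1 /=; lra.
- apply/negPn/negP => iNS.
  have := @sum_ge1 _ (fun i => k i == m) [predC S] i.
  rewrite ki eqxx inE /= iNS => /(_ isT isT); move: H1 h1_ge0 h2_ge0 h3_ge0.
  rewrite /H /h1 /=; lra.
Qed.

End Chain.

(** * Supporting prices and equilibrium *)

Lemma finite_norm_bound (R : realType) (I : finType) (f : I -> R) :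
  exists B, forall i, `|f i| <= B.
Proof.
exists (\sum_i `|f i|) => i; rewrite (bigD1 i) //= lerDl.
by apply: sumr_ge0.
Qed.

Lemma superlevel_prices (R : realType) (n m : nat) (k : 'I_n -> nat)
    (v : 'I_m -> {set 'I_n} -> R) :
    (0 < m)%N -> (forall i, (k i <= m)%N) ->
  exists (s : {perm 'I_m}) (g : {set 'I_n} -> R), graphical g /\
    forall b S, v b S - g S <=
      v b (superlevel k (s b)) - g (superlevel k (s b)).
Proof.
case: m v => // m v _ km.
have [s [q q_opt]] := assignment_prices (fun b c => v b (superlevel k c)) ord0.
(* Levels that coincide as sets share a price: each is optimal for its holder, who could take the
   other. *)
have q_eq c c' : superlevel k (val c) = superlevel k (val c') -> q c = q c'.
  move=> E; have := q_opt ((s^-1)%g c) c'; have := q_opt ((s^-1)%g c') c.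
  by rewrite !permKV E; lra.
have [c cm E|l gl lE] := @superlevel_interpolation R n k (fun c => q (inord c)) m.
  by apply: q_eq; rewrite /= !inordK // ltnW.
have [h [c0 [gh h0 h1]]] := @superlevel_penalty R n k m.+1 isT km.
have [B Bu] := finite_norm_bound (fun x : 'I_m.+1 * {set 'I_n} => v x.1 x.2 - l x.2).
(* Off the chain [h] is larger by at least 1, so the factor [2 * B] covers any change of
   [v b - l]. *)
exists s, (fun S => l S + 2 * B * h S); split; first exact/graphicalD/graphicalZ.
move=> b S; have hs := h0 (s b) (ltn_ord _).
have l_chain (c : 'I_m.+1) : l (superlevel k c) = q c - q ord_max.
  rewrite lE (minn_idPl (leq_ord c)) inord_val; congr (_ - q _).
  by apply: val_inj; rewrite /= inordK.
case: (h1 S) => [[c cm ->]|hS].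
  have := q_opt b (Ordinal cm); have := l_chain (Ordinal cm).
  have := l_chain (s b); have := h0 c cm => /= hc -> ->.
  have -> : h (superlevel k c) = h (superlevel k (s b)) by lra.
  lra.
have := Bu (b, S); have := Bu (b, superlevel k (s b)) => /=.
rewrite !ler_norml => /andP[B1 B2] /andP[B3 B4].
have B0 : 0 <= 2 * B by lra.
have := ler_wpM2l B0 hS.
have -> : h (superlevel k (s b)) = - c0 by lra.
lra.
Qed.

Theorem theorem3p3 (R : realType) (n m : nat) (hn : (1 <= n)%N) (hm : (1 <= m)%N)
    (astar : {ffun 'I_n -> int}) (hastar : forall i, 0 <= astar i <= m%:Z) :
  exists a : {ffun coordinate n -> int},
    vertex_proj a = astar /\
    forall v : 'I_m -> {set 'I_n} -> R,
      (forall b, graphical (v b)) ->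
      exists (p : {ffun coordinate n -> R})
             (x : 'I_m -> {ffun coordinate n -> int}),
        (forall b k, x b k = 0 \/ x b k = 1) /\
        competitive_equilibrium v a p x.
Proof.
pose k i := `|astar i|%N.
have kE i : (k i)%:Z = astar i by rewrite gez0_abs //; case/andP: (hastar i).
have km i : (k i <= m)%N by rewrite -lez_nat kE; case/andP: (hastar i).
exists (\sum_(c < m) bundle_vector (superlevel k c)); split.
  apply/ffunP => i; rewrite ffunE sum_ffunE -kE.
  under eq_bigr do rewrite ffunE inE.
  (* Vertex [i] lies in the levels [c < k i], all below [m], hence in exactly [k i] summands. *)
  rewrite -[k i in RHS]card_ord -sum1_card (big_ord_widen m (fun=> 1%N)) //.
  rewrite -[RHS]natz natr_sum [RHS]big_mkcond.
  by apply: eq_bigr => c _; case: (_ < _)%N.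
move=> v _; have [s [g [[p gE] g_opt]]] := superlevel_prices v hm km.
exists p, (fun b => bundle_vector (superlevel k (s b))); split.
  move=> b [i|e]; rewrite ffunE; first by case: (_ \in _); [right | left].
  by case: (_ \subset _); [right | left].
(* The permutation only reorders the sum, so the same [a] serves every market. *)
split; first exact: (reindex_inj (@perm_inj _ s)).
by move=> b; exists (superlevel k (s b)) => // S; rewrite /utility -!gE.
Qed.
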